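(* Let $G$ be a finite graph. In the cat-and-noisy-mouse game played on $G$ (described in the context), the cat has a winning strategy if and only if $G$ is a forest.
   Context: The game is played by two players, the cat and the mouse, on a finite graph $G$ known to both, in discrete rounds $i=1,2,3,\dots$. In round $i$ the cat chooses a vertex $c_i$ of $G$ and the mouse occupies a vertex $m_i$ of $G$. The cat's choice is unrestricted among all vertices of $G$, whereas the mouse must move along an edge in every round: $m_i$ and $m_{i+1}$ must be distinct and adjacent for every $i$ (the mouse's starting vertex $m_1$ is arbitrary). The mouse's position is not revealed to the cat. Let $d_i=\mathrm{dist}_G(c_i,m_i)$. After round $i$ the cat receives the following information: (1) whether $d_i=0$, $d_i=1$, or $d_i\ge 2$; and (2) for $i\ge 2$, whether $d_i\le d_{i-1}$ or $d_i>d_{i-1}$. The cat's choice $c_i$ may depend on all information received in rounds $1,\dots,i-1$. The cat catches the mouse in round $i$ if $c_i=m_i$, and the cat wins (and the game ends) in the first round in which this happens. A winning strategy for the cat is a strategy such that for every admissible sequence of mouse positions $m_1,m_2,\dots$ (each $m_{i+1}$ a neighbor of $m_i$), the mouse is caught in some finite round; the mouse wins if it can avoid being caught indefinitely. *)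

(* Defs.v *)
From mathcomp Require Import all_boot.

Set Implicit Arguments.
Unset Strict Implicit.
Unset Printing Implicit Defensive.

(* A finite simple graph is a finType T with a symmetric irreflexive e : rel T. *)

Definition forest (T : finType) (e : rel T) : Prop :=
  forall c : seq T, 2 < size c -> ~ ucycle e c.

Definition walk (T : finType) (e : rel T) (n : nat) (x y : T) : bool :=
  [exists p : n.-tuple T, path e x p && (last x p == y)].

(* Least length of a walk from x to y; None stands for infinite distance. A
   shortest walk has length < #|T|, so the search is exhaustive: see dist_SomeP
   and dist_NoneP. *)
Definition dist (T : finType) (e : rel T) (x y : T) : option nat :=
  ohead [seq n <- iota 0 #|T| | walk e n x y].

Definition dist_le (d d' : option nat) : bool :=
  match d, d' with
  | _, None => true
  | None, Some _ => false
  | Some n, Some n' => n <= n'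
  end.

Variant proximity := At0 | At1 | AtLeast2.

Definition proximity_of (d : option nat) : proximity :=
  match d with
  | Some 0 => At0
  | Some 1 => At1
  | _ => AtLeast2
  end.

(* The second component is None in the first round; in later rounds it is
   Some b, where b says whether the distance is at most the previous one. *)
Definition info := (proximity * option bool)%type.

(* The cat's own past choices are determined by the strategy and the information
   received so far, so only the latter is an argument. *)
Definition strategy (T : finType) := seq info -> T.

Definition mouse_admissible (T : finType) (e : rel T) (m : nat -> T) : Prop :=
  forall i, m i != m i.+1 /\ e (m i) (m i.+1).

(* Information received in the first n rounds, oldest first. Rounds are numbered
   from 0: in round i the mouse is at m i and the cat chooses
   s (history e s m i). *)
Fixpoint history (T : finType) (e : rel T) (s : strategy T) (m : nat -> T)
    (n : nat) : seq info :=
  if n is i.+1 then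
    let d := dist e (s (history e s m i)) (m i) in
    rcons (history e s m i)
      (proximity_of d,
       if i is j.+1
       then Some (dist_le d (dist e (s (history e s m j)) (m j)))
       else None)
  else [::].

Definition cat_position (T : finType) (e : rel T) (s : strategy T)
    (m : nat -> T) (i : nat) : T :=
  s (history e s m i).

(* The play is continued formally after a capture; this is harmless, since
   information received after the first capture does not affect it. *)
Definition winning_strategy (T : finType) (e : rel T) (s : strategy T) : Prop :=
  forall m : nat -> T, mouse_admissible e m ->
    exists i, cat_position e s m i = m i.

Definition cat_wins (T : finType) (e : rel T) : Prop :=
  exists s : strategy T, winning_strategy e s.

Section DistSpec.
Variables (T : finType) (e : rel T).

Lemma walkP n x y :
  reflect (exists p, [/\ path e x p, last x p = y & size p = n]) (walk e n x y).
Proof.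
apply: (iffP existsP) => [[p /andP[ep /eqP lp]] | [p [ep lp sp]]].
  by exists p; split; rewrite ?size_tuple.
by exists (Tuple (introT eqP sp)); rewrite /= ep lp eqxx.
Qed.

Lemma walk_short n x y :
  walk e n x y -> exists k, [/\ k <= n, k < #|T| & walk e k x y].
Proof.
case/walkP=> p [ep lp <-]; case: (shortenP ep) lp => p' ep' up' sp' lp'.
exists (size p'); split.
- by case/andP: up' => _ /uniq_leq_size; apply.
- by rewrite -[_.+1]/(size (x :: p')) -(card_uniqP up') max_card.
by apply/walkP; exists p'.
Qed.

Lemma dist_SomeP x y n :
  dist e x y = Some n <-> walk e n x y /\ forall k, walk e k x y -> n <= k.
Proof.
have min0 k m l : ohead [seq i <- iota m l | walk e i x y] = Some k ->
    [/\ walk e k x y, m <= k < m + l & forall i, m <= i < k -> ~~ walk e i x y].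
  elim: l m => //= l IHl m; case: ifPn => [wm [<-] | wm /IHl[wk mk IHk]].
    by rewrite leqnn addnS ltnS leq_addr; split=> // i; case: ltngtP.
  rewrite addnS -addSn; case/andP: (mk) => /ltnW-> ->; split=> // i /andP[].
  by rewrite leq_eqVlt => /orP[/eqP<- // | mi ik]; apply: IHk; rewrite mi.
split=> [/min0[wn _ minn] | [wn minn]].
  by split=> // k wk; rewrite leqNgt; apply: contraTN wk => kn; apply: minn.
have [k [kn kT wk]] := walk_short wn.
have: k \in [seq i <- iota 0 #|T| | walk e i x y].
  by rewrite mem_filter wk mem_iota.
rewrite /dist; case def_s: [seq _ <- _ | _] => [//|a s] _ /=.
have [|wa _ mina] := min0 a 0 #|T|; first by rewrite def_s.
congr Some; apply/eqP; rewrite eqn_leq minn // andbT.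
by rewrite leqNgt; apply/negP => na; case/negP: (mina n na).
Qed.

Lemma dist_NoneP x y : dist e x y = None <-> ~~ connect e x y.
Proof.
split=> [dN | nc].
  apply/negP => /connectP[p ep lp].
  have wp : walk e (size p) x y by apply/walkP; exists p.
  have [k [_ kT wk]] := walk_short wp.
  have: k \in [seq i <- iota 0 #|T| | walk e i x y].
    by rewrite mem_filter wk mem_iota.
  by move: dN; rewrite /dist; case: [seq _ <- _ | _].
case def_d: (dist e x y) => [n|//]; case/dist_SomeP: def_d => /walkP[p [ep lp _]] _.
by case/negP: nc; apply/connectP; exists p.
Qed.

End DistSpec.

(* Main.v *)
Require Import Defs.
From mathcomp Require Import all_boot.
From mathcomp Require Import zify.

Set Implicit Arguments.
Unset Strict Implicit.
Unset Printing Implicit Defensive.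

(* On a cycle the mouse always has two neighbours to go to, and the cat's next
   vertex covers at most one of them.

   In a forest the cat keeps a base vertex [b] and a set [B] of neighbours of
   [b] such that the mouse is in one of the branches at [b] through [B], and
   shrinks the union of these branches.  It waits at [b] until the mouse is
   adjacent or its distance increases.  In the second case the distance is at
   least 3, and probing two vertices of [B] in turn eliminates the branch of one
   of them.  In the first case the distance is 2 one round later; probing the
   children of some [j] in [B] one at a time, with returns to [b] in between,
   either eliminates the branch of [j] or shows that the mouse is in it, and then
   the cat moves its base to [j].  Distances in a forest change by exactly one
   along each edge, which makes the two comparisons informative. *)

(** * Graph distance as a natural number *)

Section Distance.

Variables (T : finType) (e : rel T).
Hypotheses (e_sym : symmetric e) (e_irr : irreflexive e).

(** Unreachable vertices get the meaningless value 0, so most facts about it come with a [connect]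
    or [walk] hypothesis. *)
Definition ndist (x y : T) : nat := odflt 0 (dist e x y).

Lemma distE x y : connect e x y -> dist e x y = Some (ndist x y).
Proof.
move=> cxy; rewrite /ndist; case dxy: (dist e x y) => //.
by case/dist_NoneP/negP: dxy.
Qed.

Lemma ndist_walk x y : connect e x y -> walk e (ndist x y) x y.
Proof. by move/distE/dist_SomeP=> []. Qed.

Lemma walk_connect n x y : walk e n x y -> connect e x y.
Proof. by case/walkP=> p [ep <- _]; apply/connectP; exists p. Qed.

Lemma ndist_min n x y : walk e n x y -> ndist x y <= n.
Proof. by move=> w; case/dist_SomeP: (distE (walk_connect w)) => _; apply. Qed.

Lemma ndistxx x : ndist x x = 0.
Proof.
by apply/eqP; rewrite -leqn0; apply: ndist_min; apply/walkP; exists [::].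
Qed.

Lemma ndist_eq0 x y : connect e x y -> ndist x y = 0 -> x = y.
Proof. by move/ndist_walk=> w d0; move: w; rewrite d0 => /walkP[[|z p] []]. Qed.

Lemma walk_sym n x y : walk e n x y -> walk e n y x.
Proof.
case/walkP=> p [ep <- <-]; apply/walkP; exists (rev (belast x p)).
split; last by rewrite size_rev size_belast.
  by rewrite rev_path; under eq_path => u v do rewrite e_sym.
by case: p {ep} => // z p; rewrite /= rev_cons last_rcons.
Qed.

Lemma connect_symm : connect_sym e.
Proof. exact: sym_connect_sym. Qed.

Lemma ndistC x y : connect e x y -> ndist x y = ndist y x.
Proof.
move=> cxy; have cyx : connect e y x by rewrite connect_symm.
by apply/eqP; rewrite eqn_leq !ndist_min // walk_sym // ndist_walk.
Qed.

Lemma ndist_step x y v : e x y -> connect e y v -> ndist x v <= (ndist y v).+1.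
Proof.
move=> exy /ndist_walk/walkP[p [ep lp sp]].
by apply: ndist_min; apply/walkP; exists (y :: p); rewrite /= exy ep sp.
Qed.

Lemma ndist_pred x v : connect e x v -> x != v ->
  exists y, e x y /\ ndist x v = (ndist y v).+1.
Proof.
move=> cxv xv; case/walkP: (ndist_walk cxv) => -[|y p] [ep lp sp].
  by rewrite -lp eqxx in xv.
case/andP: ep => exy ep; exists y; split=> //.
have w : walk e (size p) y v by apply/walkP; exists p.
have := ndist_step exy (walk_connect w); have := ndist_min w.
by move: sp => /=; lia.
Qed.

Lemma ndist1 x y : e x y -> ndist x y = 1.
Proof.
move=> exy; have := ndist_step exy (connect0 e y); rewrite ndistxx.
case d0: (ndist x y) => [|[|//]] // _.
by have := exy; rewrite (ndist_eq0 (connect1 exy) d0) e_irr.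
Qed.

Lemma ndist_eq1 x y : connect e x y -> ndist x y = 1 -> e x y.
Proof.
by move/ndist_walk=> w d1; move: w; rewrite d1 => /walkP[[|z [|? ?]] [] //=];
   rewrite andbT => exz <-.
Qed.

End Distance.

(** * The cat's knowledge, and strategies extracted from it *)

Section Knowledge.

Variables (T : finType) (e : rel T).

(** Capture is left out: [knowledge_after] records its absence by [m' != c'], and two booleans hold
    the rest. *)
Definition response (c m c' m' : T) : bool * bool :=
  (if proximity_of (dist e c' m') is At1 then true else false,
   dist_le (dist e c' m') (dist e c m)).

Definition knowledge_after (c : T) (K : T -> Prop) (c' : T) (r : bool * bool) :
    T -> Prop :=
  fun m' => m' != c' /\ exists m, [/\ K m, e m m' & response c m c' m' = r].

(* [wins c K]: having just played [c], and knowing that the mouse is uncaught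
   at a vertex satisfying [K], the cat can force a capture. *)
Inductive wins (c : T) (K : T -> Prop) : Prop :=
| wins_none of (forall m, ~ K m)
| wins_play c' of (forall r, wins c' (knowledge_after c K c' r)).

Lemma wins_sub c (K K' : T -> Prop) :
  (forall m, K' m -> K m) -> wins c K -> wins c K'.
Proof.
move=> sub w; elim: w K' sub => {c K} [c K K0 | c K c' _ IH] K' sub.
  by apply: wins_none => m /sub; apply: K0.
apply: (@wins_play _ _ c') => r; apply: (IH r) => m' [m'c [m [Km emm' rm]]].
by split=> //; exists m; split=> //; apply: sub.
Qed.

Lemma wins_move c c' (K : T -> Prop) :
    (forall m, K m -> connect e c m /\ connect e c' m) ->
    (forall near closer : bool, wins c' (fun m' => m' != c' /\
       exists m, [/\ K m, e m m', (ndist e c' m' == 1) = near &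
                     (ndist e c' m' <= ndist e c m) = closer])) ->
  wins c K.
Proof.
move=> conn win; apply: (@wins_play _ _ c') => -[near closer].
apply: wins_sub (win near closer) => m' [m'c [m [Km emm' rm]]].
split=> //; exists m; have [cm c'm] := conn _ Km.
have c'm' : connect e c' m' by apply: connect_trans c'm (connect1 emm').
move: rm; rewrite /response !distE //= => -[<- <-]; split=> //.
by case: (ndist e c' m') => [|[|?]].
Qed.

Lemma wins_move_blind c c' (K : T -> Prop) :
  wins c' (fun m' => m' != c' /\ exists2 m, K m & e m m') -> wins c K.
Proof.
move=> win; apply: (@wins_play _ _ c') => r.
by apply: wins_sub win => m' [m'c [m [Km emm' _]]]; split=> //; exists m.
Qed.

(** The cat follows its plan for [K1]. As [A] is closed under moves, the mouse is always either
    covered by that plan or in [A]; when the plan runs out, only [A] is left. *)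
Lemma wins_union c (K K1 A : T -> Prop) :
    (forall m m', A m -> e m m' -> A m') ->
    (forall c' K', (forall m, K' m -> A m) -> wins c' K') ->
    wins c K1 -> (forall m, K m -> K1 m \/ A m) ->
  wins c K.
Proof.
move=> closedA winA w; elim: w K => {c K1} [c K1 K0 | c K1 c' _ IH] K sub.
  by apply: winA => m /sub[/K0|].
apply: (@wins_play _ _ c') => r; apply: (IH r) => m' [m'c [m [Km emm' rm]]].
case: (sub _ Km) => [K1m | Am]; last by right; apply: closedA emm'.
by left; split=> //; exists m.
Qed.

(** A [wins] derivation is a proposition and cannot be eliminated into a strategy; its tree of moves
    is recovered as data by choice over the four responses. *)
Inductive plan := Stop | Play of T & (bool * bool -> plan).

Fixpoint catches (p : plan) (c : T) (m : nat -> T) (n : nat) : Prop :=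
  if p is Play c' k then
    c' = m n.+1 \/ catches (k (response c (m n) c' (m n.+1))) c' m n.+1
  else False.

Lemma choice_bool2 (A : Type) (P : bool * bool -> A -> Prop) :
  (forall r, exists x, P r x) -> exists f, forall r, P r (f r).
Proof.
move=> ex; have [x1 P1] := ex (true, true); have [x2 P2] := ex (true, false).
have [x3 P3] := ex (false, true); have [x4 P4] := ex (false, false).
exists (fun r => if r.1 then if r.2 then x1 else x2 else if r.2 then x3 else x4).
by case=> [[] []].
Qed.

Lemma wins_plan c K : wins c K -> exists p, forall m n,
  mouse_admissible e m -> K (m n) -> catches p c m n.
Proof.
elim=> {c K} [c K K0 | c K c' _ IH]; first by exists Stop => m n _ /K0.
have [k kP] := choice_bool2 IH; exists (Play c' k) => m n adm Km /=.
have [->|ne] := eqVneq c' (m n.+1); [by left | right].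
apply: kP => //; split; first by rewrite eq_sym.
by exists (m n); split=> //; case: (adm n).
Qed.

Variable c0 : T.

Fixpoint run (p : plan) (h : seq info) : T :=
  if p is Play c k then
    if h is (x, o) :: h' then
      run (k (if x is At1 then true else false, odflt true o)) h'
    else c
  else c0.

(** The answer to the opening move [c0] carries no comparison and is discarded. Every later one has
    a comparison, so the default in [run] never matters. *)
Definition plan_strategy (p : plan) : strategy T :=
  fun h => if h is _ :: h' then run p h' else c0.

Lemma catches_run (s : strategy T) p c m n :
    catches p c m n -> s (history e s m n) = c ->
    (forall h, s (history e s m n.+1 ++ h) = run p h) ->
  exists i, cat_position e s m i = m i.
Proof.
elim: p c n => //= c' k IH c n cat sc srun; have := srun [::]; rewrite cats0.
case: cat => [-> sn | cat sn]; first by exists n.+1.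
apply: (IH _ c' n.+1 cat sn) => h.
rewrite cat_rcons srun /=; congr (run (k _) h).
by rewrite /response -sc -sn.
Qed.

Lemma wins_cat_wins : wins c0 (fun=> True) -> cat_wins e.
Proof.
case/wins_plan=> p pP; exists (plan_strategy p) => m adm.
exact: (@catches_run _ p c0 m 0 (pP m 0 adm I)).
Qed.

End Knowledge.

(* [lia] blows up on the boolean graph hypotheses of the context, so only the
   statements about distances are kept. *)
Ltac ndist_lia :=
  intros;
  repeat match goal with
  | H : ?P |- _ =>
      lazymatch type of P with Prop => idtac end;
      lazymatch P with
      | forall _, _ => idtac
      | context [ndist _ _ _] => fail
      | _ => idtac
      end;
      clear H
  end;
  lia.

(** * Distances, branches and regions in a forest *)

Section Forest.

Variables (T : finType) (e : rel T).
Hypotheses (e_sym : symmetric e) (e_irr : irreflexive e).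
Hypothesis e_forest : forest e.

Local Notation d := (ndist e).
Implicit Types (b j k m v x : T) (B : {set T}).

Definition rel_avoiding (b : T) : rel T := [rel u v | [&& e u v, u != b & v != b]].

(** A repetition-free path from [j] to [j'] avoiding [b], if not empty, would close up through [b]
    to a cycle of length at least 3. *)
Lemma neighbors_separated b j j' : e b j -> e b j' ->
  connect (rel_avoiding b) j j' -> j = j'.
Proof.
move=> ebj ebj' /connectP[p ep lp]; case: (shortenP ep) lp => q eq uq _ lq.
case: q eq uq lq => // z q eq uq lq; case: (@e_forest [:: b, j, z & q]) => //.
have eq' : path e j (z :: q) by apply: sub_path eq => u v /and3P[].
have nb : all (predC1 b) (z :: q).
  elim: (z :: q) j {lq eq' uq ebj ep} eq => //= a s IHs j /andP[/and3P[_ _ ->]].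
  exact: IHs.
have jb : j != b by case/andP: eq => /and3P[].
rewrite /ucycle; apply/andP; split.
  by move: eq' lq => /= eq' lq; rewrite rcons_path ebj /= andbA eq' -lq e_sym.
rewrite [uniq _]/=; move: uq => /= ->; rewrite andbT !inE eq_sym negb_or jb /=.
move: nb => /= /andP[zb nq]; rewrite eq_sym negb_or zb /=.
by apply/negP => /(allP nq); rewrite /= eqxx.
Qed.

(** After its first vertex, a geodesic from [w] is strictly closer to [v] than [b] is, so it never
    meets [b]. *)
Lemma connect_avoiding b v w : connect e b v -> connect e w v ->
  w != b -> v != b -> d w v <= d b v -> connect (rel_avoiding b) w v.
Proof.
move=> cbv; have [n] := ubnP (d w v); elim: n w => // n IHn w.
rewrite ltnS => wn cwv wb vb wle.
have [->|wv] := eqVneq w v; first exact: connect0.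
have [y [ewy dwy]] := ndist_pred cwv wv.
have cyv : connect e y v.
  by apply: connect_trans cwv; apply: connect1; rewrite e_sym.
have yb : y != b by apply: contraTneq wle => yb; rewrite dwy yb ltnn.
apply: (@connect_trans _ _ y).
  by apply: connect1; rewrite /rel_avoiding /= ewy wb yb.
by apply: IHn => //; ndist_lia.
Qed.

(* At most one neighbour is weakly closer to [v]: geodesics from two of them
   to [v] would avoid [b] and close up a cycle through [b]. *)
Lemma closer_neighbor_unique b j j' v : connect e b v -> v != b ->
  e b j -> e b j' -> d j v <= d b v -> d j' v <= d b v -> j = j'.
Proof.
move=> cbv vb ebj ebj' dj dj'; apply: (@neighbors_separated b) => //.
have sym : connect_sym (rel_avoiding b).
  by apply: sym_connect_sym => u w; rewrite /rel_avoiding /= e_sym [(u != b) && _]andbC.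
have conn i : e b i -> d i v <= d b v -> connect (rel_avoiding b) i v.
  move=> ebi di; apply: connect_avoiding => //.
    by apply: connect_trans cbv; apply: connect1; rewrite e_sym.
  by apply: contraTneq ebi => ->; rewrite e_irr.
by apply: connect_trans (conn _ ebj dj) _; rewrite sym conn.
Qed.

(** If the distances were equal, [y] and the next vertex [z] of a geodesic from [x] would coincide
    by uniqueness, yet [z] is strictly closer to [v]. *)
Lemma ndist_edge x y v : connect e x v -> e x y ->
  d x v = (d y v).+1 \/ d y v = (d x v).+1.
Proof.
move=> cxv exy; have eyx : e y x by rewrite e_sym.
have cyv : connect e y v by apply: connect_trans cxv; apply: connect1.
have h1 := ndist_step exy cyv; have h2 := ndist_step eyx cxv.
have [dxy|] := eqVneq (d x v) (d y v); last by ndist_lia.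
have [xv|xv] := eqVneq x v.
  move: dxy; rewrite xv ndistxx => /esym /(ndist_eq0 cyv) yv.
  by move: exy; rewrite xv yv e_irr.
have [z [exz dz]] := ndist_pred cxv xv.
have yz : y = z.
  by rewrite eq_sym in xv; apply: (@closer_neighbor_unique x y z v) => //; ndist_lia.
by move: dxy dz; rewrite yz; ndist_lia.
Qed.

Lemma ndist_edger b v v' : connect e b v -> e v v' ->
  d b v' = (d b v).+1 \/ d b v = (d b v').+1.
Proof.
move=> cbv evv'.
have cbv' : connect e b v' by apply: connect_trans cbv (connect1 evv').
rewrite (ndistC e_sym cbv) (ndistC e_sym cbv').
have cvb : connect e v b by rewrite connect_symm.
by have := ndist_edge cvb evv'; tauto.
Qed.

(** In a forest, the component of [j] once [b] is deleted. *)
Definition branch (b j v : T) : bool :=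
  [&& e b j, connect e b v & d b v == (d j v).+1].

Lemma branchP b j v :
  reflect [/\ e b j, connect e b v & d b v = (d j v).+1] (branch b j v).
Proof.
by apply: (iffP and3P) => -[h1 h2 h3]; split=> //; apply/eqP.
Qed.

Lemma branch_neq b j v : branch b j v -> v != b.
Proof. by case/branchP=> _ _; apply: contra_eq_neq => ->; rewrite ndistxx. Qed.

Lemma branch_connect b j v : branch b j v -> connect e b v.
Proof. by case/branchP. Qed.

Lemma branch_edge b j v : branch b j v -> e b j.
Proof. by case/branchP. Qed.

Lemma branch_self b j : e b j -> branch b j j.
Proof.
by move=> ebj; apply/branchP; rewrite ndistxx ndist1 // connect1.
Qed.

Lemma branch_exists b v : connect e b v -> v != b -> exists j, branch b j v.
Proof.
rewrite eq_sym => cbv bv; have [j [ebj dj]] := ndist_pred cbv bv.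
by exists j; apply/branchP.
Qed.

Lemma branch_unique b j j' v : branch b j v -> branch b j' v -> j = j'.
Proof.
move=> bj; have vb := branch_neq bj.
case/branchP: bj => ebj cbv dj /branchP[ebj' _ dj'].
by apply: (@closer_neighbor_unique b _ _ v) => //; ndist_lia.
Qed.

(** Whichever of [v] and [v'] is farther from [b] inherits the branch of the nearer one; uniqueness
    identifies the two branches. *)
Lemma branch_move b j v v' : branch b j v -> e v v' -> v' != b -> branch b j v'.
Proof.
move=> bj evv' v'b; case/branchP: (bj) => ebj cbv dj.
have ev'v : e v' v by rewrite e_sym.
have ejb : e j b by rewrite e_sym.
have cbv' : connect e b v' by apply: connect_trans cbv (connect1 evv').
have [i bi] := branch_exists cbv' v'b; case/branchP: (bi) => ebi _ di.
have eib : e i b by rewrite e_sym.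
suff: branch b j v' \/ branch b i v by case=> // /(branch_unique bj) ->.
have [lt|lt] := ndist_edger cbv evv'; [left | right]; apply/branchP; split=> //.
  have cjv' := connect_trans (connect1 ejb) cbv'.
  have := ndist_step ebj cjv'.
  by have := ndist_edger (connect_trans (connect1 ejb) cbv) evv'; ndist_lia.
have civ := connect_trans (connect1 eib) cbv.
have := ndist_step ebi civ.
by have := ndist_edger (connect_trans (connect1 eib) cbv') ev'v; ndist_lia.
Qed.

Lemma branch_other b j j' v : branch b j v -> e b j' -> j' != j ->
  d j' v = (d b v).+1.
Proof.
move=> bj ebj' ne; case/branchP: (bj) => _ cbv _.
have [dj'|//] := ndist_edge cbv ebj'.
case/eqP: ne; apply: (@branch_unique b _ _ v) => //; exact/branchP.
Qed.

Lemma branch_descend b j v : branch b j v -> v != j ->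
  exists2 k, k != b & branch j k v.
Proof.
case/branchP=> ebj cbv dj vj.
have cjv : connect e j v by apply: connect_trans cbv; apply: connect1; rewrite e_sym.
have [k bk] := branch_exists cjv vj; exists k => //.
by apply: contraTneq bk => ->; apply/negP => /branchP[_ _]; ndist_lia.
Qed.

Lemma branch_ascend b j k v : e b j -> k != b -> branch j k v -> branch b j v.
Proof.
move=> ebj kb bk; apply/branchP; split=> //.
  exact: connect_trans (connect1 ebj) (branch_connect bk).
by rewrite (branch_other bk) // 1?e_sym // eq_sym.
Qed.

Definition region (b : T) (B : {set T}) : {set T} :=
  [set m | [exists j in B, branch b j m]].

Lemma regionP b B m :
  reflect (exists2 j, j \in B & branch b j m) (m \in region b B).
Proof. by rewrite inE; apply: exists_inP. Qed.

Lemma region_neq b B m : m \in region b B -> m != b.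
Proof. by case/regionP=> j _ /branch_neq. Qed.

Lemma region_connect b B m : m \in region b B -> connect e b m.
Proof. by case/regionP=> j _ /branch_connect. Qed.

Lemma region_move b B m m' :
  m \in region b B -> e m m' -> m' != b -> m' \in region b B.
Proof.
case/regionP=> j jB bj emm' m'b; apply/regionP; exists j => //.
exact: branch_move emm' m'b.
Qed.

Lemma region_ndist_move b B m m' : m \in region b B -> e m m' ->
  d b m' = (d b m).+1 \/ d b m = (d b m').+1.
Proof. by move/region_connect; apply: ndist_edger. Qed.

Lemma region_ndist b B m : m \in region b B -> 0 < d b m.
Proof. by case/regionP=> j _ /branchP[_ _ ->]. Qed.

Lemma ndist_gt0 b m : connect e b m -> m != b -> 0 < d b m.
Proof.
by move=> cbm mb; rewrite lt0n; apply: contraNneq mb => /(ndist_eq0 cbm) ->.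
Qed.

(** * Shrinking a region, given that all smaller regions are won *)

Section Descent.

Variables (b : T) (B : {set T}).
Hypothesis B_adj : {in B, forall j, e b j}.
Hypothesis wins_smaller : forall b' B', {in B', forall j, e b' j} ->
  #|region b' B'| < #|region b B| -> wins e b' (fun m => m \in region b' B').

Lemma mem_region_self j : j \in B -> j \in region b B.
Proof. by move=> jB; apply/regionP; exists j => //; apply/branch_self/B_adj. Qed.

(** From distance at least 2 the mouse cannot step to [b], so after a probe of [j] it lies beyond a
    child of [j]; the region based there has lost [j]. *)
Lemma wins_known_branch c j (K : T -> Prop) : j \in B ->
  (forall m, K m -> branch b j m /\ 1 < d b m) -> wins e c K.
Proof.
move=> jB KP; have ebj := B_adj jB; apply: (@wins_move_blind _ _ _ j).
pose B' := [set k | e j k & k != b].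
have sub m : m \in region j B' -> branch b j m.
  by case/regionP=> k; rewrite inE => /andP[_ kb]; apply: branch_ascend.
apply: wins_sub (wins_smaller (b' := j) (B' := B') _ _).
- move=> m' [m'j [m Km emm']]; have [bj dm] := KP _ Km.
  have m'b : m' != b.
    apply: contraTneq dm => m'b; rewrite m'b e_sym in emm'.
    by rewrite (ndist1 e_irr emm').
  have [k kb bk] := branch_descend (branch_move bj emm' m'b) m'j.
  by apply/regionP; exists k => //; rewrite inE kb (branch_edge bk).
- by move=> k; rewrite inE => /andP[].
apply/proper_card/properP; split.
  by apply/subsetP=> m /sub bj; apply/regionP; exists j.
by exists j; [exact: mem_region_self | apply: contraTN isT => /region_neq/eqP].
Qed.

(** Playing [b] makes the odd distance even and positive, hence at least 2. *)
Lemma wins_known_branch_odd c j (K : T -> Prop) : j \in B ->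
  (forall m, K m -> branch b j m /\ odd (d b m)) -> wins e c K.
Proof.
move=> jB KP; apply: (@wins_move_blind _ _ _ b).
apply: (@wins_known_branch _ j) => // m' [m'b [m Km emm']].
have [bj dm] := KP _ Km; have bj' := branch_move bj emm' m'b; split=> //.
have := ndist_gt0 (branch_connect bj') m'b.
by have := ndist_edger (branch_connect bj) emm'; ndist_lia.
Qed.

Lemma wins_eliminated c j (K : T -> Prop) : j \in B ->
  (forall m, K m -> m \in region b (B :\ j)) -> wins e c K.
Proof.
move=> jB KP; apply: (@wins_move_blind _ _ _ b).
apply: wins_sub (wins_smaller (b' := b) (B' := B :\ j) _ _).
- by move=> m' [m'b [m /KP Km emm']]; apply: region_move emm' _.
- by move=> k; rewrite inE => /andP[_]; apply: B_adj.
apply/proper_card/properP; split.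
  apply/subsetP=> m /regionP[k]; rewrite inE => /andP[_ kB] bk.
  by apply/regionP; exists k.
exists j; first exact: mem_region_self.
apply/regionP=> -[k]; rewrite !inE => /andP[kj _] bk; case/eqP: kj.
exact: branch_unique bk (branch_self (B_adj jB)).
Qed.

(** Beyond distance 2 the mouse needs more than two moves to reach [b], so it keeps its branch while
    [i] and [j] are probed. *)
Lemma wins_far c (K : T -> Prop) :
  (forall m, K m -> m \in region b B /\ 2 < d b m) -> wins e c K.
Proof.
move=> KP; have [B0|[i iB]] := set_0Vmem B.
  by apply: wins_none => m /KP[/regionP[j]]; rewrite B0 inE.
have [B1|[j]] := set_0Vmem (B :\ i).
  apply: (@wins_known_branch _ i) => // m /KP[/regionP[k kB bk] dm].
  have : k \notin B :\ i by rewrite B1 inE.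
  by rewrite in_setD1 kB andbT negbK => /eqP <-; split=> //; ndist_lia.
rewrite !inE => /andP[ji jB]; apply: (@wins_move_blind _ _ _ i).
have conn k m : k \in B -> m \in region b B -> connect e k m.
  move=> kB /region_connect; apply: connect_trans; apply: connect1.
  by rewrite e_sym B_adj.
apply: (@wins_sub _ _ _ (fun m => m \in region b B /\ 1 < d b m)).
  move=> m' [_ [m /KP[mR dm] emm']].
  have := region_ndist_move mR emm' => dm'; split; last by ndist_lia.
  apply: region_move emm' _ => //; apply: contraTneq dm => m'b.
  by move: dm'; rewrite m'b ndistxx; ndist_lia.
apply: (@wins_move _ _ _ j) => [m [mR _]|]; first by split; apply: conn.
(* The mouse is now farther from [j] than it was from [i] if it is in branch
   [i], and no farther if it is in branch [j]. *)
move=> near closer; apply: (@wins_eliminated _ (if closer then i else j)).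
  by case: closer.
move=> m' [_ [m [[/regionP[k kB bk] dm] emm' _ cl]]].
have dm' := ndist_edger (branch_connect bk) emm'.
have m'b : m' != b by apply: contraTneq dm => m'b; move: dm'; rewrite m'b ndistxx; ndist_lia.
have bk' := branch_move bk emm' m'b.
apply/regionP; exists k => //; rewrite !inE kB andbT.
apply/eqP=> kij; move: cl; case: closer kij => ? cl; subst k.
  move: cl; rewrite (branch_other bk') ?B_adj //.
  by case/branchP: bk => _ _; ndist_lia.
move: cl; rewrite (branch_other bk) ?B_adj // 1?eq_sym //.
by case/branchP: bk' => _ _; ndist_lia.
Qed.

(* Visiting the children [x] of [j] one after the other, always returning to
   [b]: to stay unnoticed in branch [j] the mouse cannot use [j], nor enter the
   subtree of [x], so it steps down from some other child of [j] and back. *)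
Lemma wins_probe_children j (X : {set T}) : j \in B ->
    {in X, forall x, e j x /\ x != b} ->
  wins e b (fun m => [/\ m \in region b B, ~~ odd (d b m) &
                        branch b j m -> m \in X /\ d b m = 2]).
Proof.
move=> jB; have ebj := B_adj jB; have ejb : e j b by rewrite e_sym.
have [n] := ubnP #|X|; elim: n X => // n IHn X; rewrite ltnS => Xn Xadj.
have [X0|[x xX]] := set_0Vmem X.
  apply: (@wins_eliminated _ j) => // m [/regionP[k kB bk] _ bj].
  apply/regionP; exists k => //; rewrite !inE kB andbT.
  by apply/eqP=> kj; subst k; case: (bj bk); rewrite X0 inE.
have [ejx xb] := Xadj _ xX.
have bx : branch b j x by apply: branch_move (branch_self ebj) ejx xb.
have conn m : m \in region b B -> connect e x m.
  move/region_connect; apply: connect_trans; rewrite connect_symm //.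
  exact: branch_connect bx.
apply: (@wins_move _ _ _ x) => [m [mR _ _]|near closer].
  by split; [apply: region_connect mR | apply: conn].
(* A neighbour of [x] other than [b] shares the branch [j] of [x]. *)
case: near.
  apply: (@wins_known_branch_odd _ j) => // m' [_ [m [[mR dm _] emm' /eqP dx _]]].
  have dm' := region_ndist_move mR emm'.
  have m'b : m' != b.
    by apply: contraNneq dm => m'b; move: dm'; rewrite m'b ndistxx; ndist_lia.
  have exm' : e x m'.
    apply: (@ndist_eq1 _ e) => //; exact: connect_trans (conn _ mR) (connect1 emm').
  by split; [apply: branch_move exm' m'b | ndist_lia].
(* An unnoticed mouse in branch [j] has stepped down from another child [z], so the route from [x]
   is through [j] and [z]; to other branches it is through [j] and [b]. *)
apply: (@wins_sub _ _ _ (fun m' => [/\ m' \in region b B, odd (d b m') &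
   if branch b j m' then d x m' = 3 /\ exists2 z, z \in X :\ x & branch j z m'
   else d x m' = (d b m').+2])).
  move=> m' [_ [m [[mR dm mj] emm' dx _]]].
  have dm' := region_ndist_move mR emm'.
  have m'b : m' != b.
    by apply: contraNneq dm => m'b; move: dm'; rewrite m'b ndistxx; ndist_lia.
  have m'R := region_move mR emm' m'b.
  split=> //; first by ndist_lia.
  have [k kB bk] := regionP _ _ _ mR; have bk' := branch_move bk emm' m'b.
  case: ifPn => bj'; last first.
    have kj : j != k by apply: contraNneq bj' => ->.
    have dj := branch_other bk' ebj kj.
    have bjb : branch j b m'.
      apply/branchP; split=> //.
      exact: connect_trans (connect1 ejb) (region_connect m'R).
    by rewrite (branch_other bjb ejx xb) dj.
  have kj := branch_unique bk' bj'; subst k; have [mX dm2] := mj bk.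
  have [ejm mb] := Xadj _ mX.
  have m'j : m' != j.
    by apply/eqP=> m'j; move: dx; rewrite m'j ndist1 1?e_sym.
  have mx : m != x.
    by apply/eqP=> mx; move: dx; rewrite -mx ndist1.
  have bm' := branch_move (branch_self ejm) emm' m'j.
  split; last by exists m => //; rewrite !inE mx.
  rewrite (branch_other bm' ejx) 1?eq_sym //.
  case/branchP: bj' => _ cbm'; have cjm' := branch_connect bm'.
  have := ndist_gt0 cjm' m'j; case/branchP: bk => _ _; ndist_lia.
apply: (@wins_move _ _ _ b) => [m [mR _ _]|near' closer'].
  by split; [apply: conn | apply: region_connect mR].
(* Outside branch [j] the answer is always closer. Inside, [d x m] and [d b m] are both 3, so closer
   means that the mouse went back up to [z]. *)
case: closer'; last first.
  apply: (@wins_known_branch _ j) => // m' [m'b [m [[mR dm mj] emm' _ far]]].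
  have [k kB bk] := regionP _ _ _ mR; have bk' := branch_move bk emm' m'b.
  have dm' := region_ndist_move mR emm'.
  have := ndist_gt0 (branch_connect bk') m'b => dm'0.
  move: mj; case: ifPn => [bj _ | _]; last by ndist_lia.
  by split; [apply: branch_move emm' m'b | ndist_lia].
apply: wins_sub (IHn (X :\ x) _ _).
- move=> m' [m'b [m [[mR dm mj] emm' _ close]]].
  have [k kB bk] := regionP _ _ _ mR; have bk' := branch_move bk emm' m'b.
  have dm' := region_ndist_move mR emm'.
  have := ndist_gt0 (branch_connect bk') m'b => dm'0.
  split; [exact: region_move emm' m'b | by ndist_lia | move=> bj'].
  have kj := branch_unique bk' bj'; subst k; move: mj; rewrite bk => -[dx [z zX bz]].
  have d2 : d b m' = 2 by ndist_lia.
  split=> //; case/branchP: (bj') => _ _ dj'.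
  have m'j : m' != j by apply/eqP=> m'j; move: dj'; rewrite d2 m'j ndistxx.
  case/branchP: (branch_move bz emm' m'j) => ejz cjm' dz.
  suff <- : z = m' by [].
  apply: (@ndist_eq0 _ e); last by ndist_lia.
  by apply: connect_trans cjm'; apply: connect1; rewrite e_sym.
- by rewrite [#|X|](cardsD1 x) xX in Xn.
- by move=> y; rewrite !inE => /andP[_ /Xadj].
Qed.

(** Playing [b] forces the mouse out to distance 2; all children of [j] are then candidates. *)
Lemma wins_near c (K : T -> Prop) :
  (forall m, K m -> m \in region b B /\ d b m = 1) -> wins e c K.
Proof.
move=> KP; apply: (@wins_move_blind _ _ _ b).
have [B0|[j jB]] := set_0Vmem B.
  by apply: wins_none => m' [_ [m /KP[/regionP[j]]]]; rewrite B0 inE.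
apply: wins_sub (@wins_probe_children j [set x | e j x & x != b] jB _).
  move=> m' [m'b [m /KP[mR dm] emm']]; have m'R := region_move mR emm' m'b.
  have d2 : d b m' = 2.
    by have := region_ndist m'R; have := region_ndist_move mR emm'; ndist_lia.
  split; rewrite ?d2 // => bj; split=> //; rewrite inE m'b andbT.
  case/branchP: bj => ebj cbm' dj; apply: (@ndist_eq1 _ e); last by ndist_lia.
  by apply: connect_trans cbm'; apply: connect1; rewrite e_sym.
by move=> x; rewrite inE => /andP[].
Qed.

(** Each uneventful round lowers the distance, hence the bound [n]; an increase from above 1 leads
    to [wins_far]. *)
Lemma wins_wait n :
  wins e b (fun m => m \in region b B /\ 1 < d b m <= n).
Proof.
elim: n => [|n IHn]; first by apply: wins_none => m [_]; ndist_lia.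
apply: (@wins_move _ _ _ b) => [m [/region_connect]|near closer] //.
have stay m' : m' != b /\ (exists m,
    [/\ m \in region b B /\ 1 < d b m <= n.+1, e m m', (d b m' == 1) = near &
        (d b m' <= d b m) = closer]) ->
  [/\ m' \in region b B, 0 < d b m', (d b m' == 1) = near &
     if closer then d b m' <= n else 2 < d b m'].
  move=> [m'b [m [[mR dm] emm' -> <-]]]; have m'R := region_move mR emm' m'b.
  have := region_ndist m'R; have := region_ndist_move mR emm'.
  by case: ifP => cl *; split=> //; ndist_lia.
case: near stay => stay.
  by apply: wins_near => m' /stay[mR _ /eqP].
case: closer stay => stay.
  by apply: wins_sub IHn => m' /stay[mR dm d1 dn]; split=> //; ndist_lia.
by apply: wins_far => m' /stay[mR _ _].
Qed.

Lemma wins_region_step : wins e b (fun m => m \in region b B).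
Proof.
apply: (@wins_move _ _ _ b) => [m /region_connect|near closer] //.
case: near.
  apply: wins_near => m' [m'b [m [mR emm' /eqP]]].
  by split=> //; apply: region_move emm' m'b.
apply: wins_sub (wins_wait (\max_m d b m)) => m' [m'b [m [mR emm' d1 _]]].
have m'R := region_move mR emm' m'b; split=> //.
by have := region_ndist m'R; have := @leq_bigmax _ (d b) m'; ndist_lia.
Qed.

End Descent.

(** * Induction on regions, then on components *)

Lemma wins_region b B : {in B, forall j, e b j} ->
  wins e b (fun m => m \in region b B).
Proof.
have [n] := ubnP #|region b B|; elim: n b B => // n IHn b B; rewrite ltnS => le_n.
move=> B_adj; apply: wins_region_step => // b' B' B'_adj lt.
by apply: IHn => //; apply: leq_trans le_n.
Qed.

Lemma wins_component c b (K : T -> Prop) :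
  (forall m, K m -> connect e b m) -> wins e c K.
Proof.
move=> conn; apply: (@wins_move_blind _ _ _ b).
apply: wins_sub (@wins_region b [set j | e b j] _) => [m' [m'b [m Km emm']]|j].
  have cbm' := connect_trans (conn _ Km) (connect1 emm').
  have [j bj] := branch_exists cbm' m'b.
  by apply/regionP; exists j => //; rewrite inE (branch_edge bj).
by rewrite inE.
Qed.

(* The components are searched one after the other: a search does not disturb
   the knowledge that the mouse is elsewhere. *)
Lemma wins_closed c (A : {set T}) (K : T -> Prop) :
  (forall m m', m \in A -> e m m' -> m' \in A) ->
  (forall m, K m -> m \in A) -> wins e c K.
Proof.
have [n] := ubnP #|A|; elim: n A c K => // n IHn A c K; rewrite ltnS => An.
move=> closedA KA; have [A0|[b bA]] := set_0Vmem A.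
  by apply: wins_none => m /KA; rewrite A0 inE.
pose A' := A :\: [set m | connect e b m].
have closedA' m m' : m \in A' -> e m m' -> m' \in A'.
  rewrite !inE => /andP[nc mA] emm'; rewrite (closedA m) // andbT.
  apply: contra nc => /connect_trans; apply; apply: connect1.
  by rewrite e_sym.
apply: (@wins_union _ _ _ _ (fun m => connect e b m) (fun m => m \in A')) => //.
- move=> c' K'; apply: IHn => //; apply: leq_trans An.
  apply/proper_card/properP; split; first exact: subsetDl.
  by exists b; rewrite // !inE connect0.
- exact: (@wins_component _ b).
by move=> m /KA mA; rewrite !inE mA andbT; case: connect; [left | right].
Qed.

End Forest.

(** * Evading the cat on a cycle *)

Section Cycle.

Variables (T : finType) (e : rel T) (s : strategy T) (c : seq T) (x0 : T).
Hypotheses (e_sym : symmetric e) (e_irr : irreflexive e).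
Hypotheses (c_cycle : ucycle e c) (c_long : 2 < size c) (x0c : x0 \in c).

(** Otherwise two steps of [next] would return to [v], impossible on at least 3 distinct
    vertices. *)
Lemma next_neq_prev v : v \in c -> next c v != prev c v.
Proof.
case/andP: c_cycle => _ uc vc; case: (rot_to vc) => i q rc.
apply/eqP=> np; have := next_prev uc v; rewrite -np -!(next_rot i uc) rc.
have: uniq (v :: q) by rewrite -rc rot_uniq.
have: 2 < size (v :: q) by rewrite -rc size_rot.
case: q {rc} => [|a [|z q]] //= _ /andP[].
rewrite !in_cons !negb_or => /and3P[va vz _] _.
by rewrite eqxx (eq_sym a) (negbTE va) eqxx => zv; rewrite zv eqxx in vz.
Qed.

Definition dodge (v w : T) : T := if next c v == w then prev c v else next c v.

Lemma dodge_neq v w : v \in c -> dodge v w != w.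
Proof.
rewrite /dodge => /next_neq_prev np.
by case: ifP => [/eqP<- | ->] //; rewrite eq_sym.
Qed.

Lemma dodge_mem v w : v \in c -> dodge v w \in c.
Proof. by rewrite /dodge; case: ifP; rewrite ?mem_prev ?mem_next. Qed.

Lemma dodge_edge v w : v \in c -> e v (dodge v w).
Proof.
case/andP: c_cycle => cyc _ vc; rewrite /dodge; case: ifP => _.
  by rewrite e_sym (prev_cycle cyc).
exact: next_cycle cyc vc.
Qed.

(* The cat's next vertex depends only on the past, so the mouse may look at it
   before choosing which way round the cycle to go. *)
Fixpoint evasion (n : nat) : seq T :=
  if n is k.+1 then
    rcons (evasion k)
      (dodge (last x0 (evasion k)) (s (history e s (nth x0 (evasion k)) k)))
  else [::].

(** [x0] only seeds the walk: the mouse starts at a neighbour of it, already dodging the cat's first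
    choice. *)
Definition evader (n : nat) : T := last x0 (evasion n.+1).

Lemma size_evasion n : size (evasion n) = n.
Proof. by elim: n => //= n IHn; rewrite size_rcons IHn. Qed.

Lemma nth_evasion n i : i < n -> nth x0 (evasion n) i = evader i.
Proof.
elim: n => // n IHn; rewrite ltnS => le_in; rewrite /= nth_rcons size_evasion.
case: ltngtP le_in => // [/IHn // | -> _].
by rewrite /evader /= last_rcons.
Qed.

Lemma history_eq (m m' : nat -> T) n :
  (forall i, i < n -> m i = m' i) -> history e s m n = history e s m' n.
Proof.
elim: n => //= n IHn eqm.
have eqh : history e s m n = history e s m' n.
  by apply: IHn => i lt_in; apply: eqm; apply: ltnW.
rewrite eqh eqm //; case: n IHn eqm eqh => // n _ eqm /=.
by case/rcons_inj=> -> _ _; rewrite eqm.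
Qed.

(** The history up to [n] reads only earlier positions, so the default of [nth] past the prefix is
    never consulted. *)
Lemma evaderE n :
  evader n = dodge (last x0 (evasion n)) (s (history e s evader n)).
Proof.
rewrite {1}/evader /= last_rcons; congr (dodge _ (s _)).
by apply: history_eq => i; apply: nth_evasion.
Qed.

Lemma evasion_mem n : last x0 (evasion n) \in c.
Proof. by elim: n => //= n IHn; rewrite last_rcons dodge_mem. Qed.

Lemma evader_admissible : mouse_admissible e evader.
Proof.
move=> i; have eE : e (evader i) (evader i.+1).
  by rewrite (evaderE i.+1) dodge_edge ?evasion_mem.
by split=> //; apply: contraTneq eE => ->; rewrite e_irr.
Qed.

Lemma evader_uncaught i : cat_position e s evader i <> evader i.
Proof. by apply/eqP; rewrite eq_sym evaderE dodge_neq ?evasion_mem. Qed.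

End Cycle.

Theorem theorem1 (T : finType) (e : rel T)
    (e_sym : symmetric e) (e_irr : irreflexive e) (T_nonempty : 0 < #|T|) :
  cat_wins e <-> forest e.
Proof.
split=> [[s win] [//|x0 c'] long cyc | e_forest].
  have x0c : x0 \in x0 :: c' by rewrite inE eqxx.
  have [i] := win _ (evader_admissible s e_sym e_irr cyc x0c).
  exact: evader_uncaught.
case/card_gt0P: T_nonempty => c0 _; apply: (@wins_cat_wins _ _ c0).
by apply: (@wins_closed _ _ e_sym e_irr e_forest _ [set: T]) => *; rewrite inE.
Qed.
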